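(* Let $n \geq 2$ be an integer and $q$ a power of a prime. Then $$\mathrm{ex}(\mathcal{L}_n(q); \wedge, \vee) = {n \brack \lfloor n/2\rfloor}_q.$$ Moreover, if $\mathcal{F}$ is a family of subspaces of $(\mathbb{F}_q)^n$ of size ${n \brack \lfloor n/2\rfloor}_q$ that contains neither a $\wedge$ nor a $\vee$ (as subposets, in the sense below), then: (1) if $n$ is even, $\mathcal{F}$ consists of all subspaces of dimension $n/2$; (2) if $n$ is odd and either $n>3$ or $q>2$, then $\mathcal{F}$ consists either of all subspaces of dimension $\lfloor n/2\rfloor$ or of all subspaces of dimension $\lceil n/2\rceil$; (3) if $n=3$ and $q=2$, then there are exactly $4$ possible configurations for $\mathcal{F}$, namely: all $1$-dimensional subspaces; all $2$-dimensional subspaces; three $1$-dimensional subspaces not contained in a common $2$-dimensional subspace together with the four $2$-dimensional subspaces that contain at most one of these three; or three $2$-dimensional subspaces not containing a common $1$-dimensional subspace together with the four $1$-dimensional subspaces that are contained in at most one of these three.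
   Context: For a prime power $q$, $\mathbb{F}_q$ is the field with $q$ elements and $\mathcal{L}_n(q)$ is the poset of all subspaces of $(\mathbb{F}_q)^n$ ordered by inclusion. Define $[n]_q = \frac{q^n-1}{q-1}$, $[n]_q! = [n]_q[n-1]_q\cdots[1]_q$, and ${n \brack k}_q = \frac{[n]_q!}{[k]_q!\,[n-k]_q!}$; this is the number of $k$-dimensional subspaces of $(\mathbb{F}_q)^n$. A poset $P$ contains a poset $Q$ if there is a subset $P_0\subseteq P$ and a bijection $\theta: Q\to P_0$ with $x\le_Q y \Rightarrow \theta(x)\le_P\theta(y)$ (extra relations among elements of $P_0$ are allowed); otherwise $P$ is $Q$-free. A subset of a poset is regarded as a poset with the induced order. $\wedge$ is the poset $\{a_0,a_1,a_2\}$ with $a_1<a_0$, $a_2<a_0$ (a 2-broom), and $\vee$ is the poset $\{a_0,a_1,a_2\}$ with $a_0<a_1$, $a_0<a_2$ (a 2-fork). $\mathrm{ex}(P; P_1,\dots,P_k)$ is the maximum size of a subset of $P$ that contains none of $P_1,\dots,P_k$. *)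

(* Defs.v *)
From HB Require Import structures.
From mathcomp Require Import all_boot all_order all_algebra.

Set Implicit Arguments.
Unset Strict Implicit.
Unset Printing Implicit Defensive.

Import Order.TTheory GRing.Theory.
Local Open Scope ring_scope.

(* Division is taken in [rat], so no exactness of the quotients is presupposed. *)
Definition qint (q n : nat) : rat := (q%:R ^+ n - 1) / (q%:R - 1).

Definition qfact (q n : nat) : rat := \prod_(1 <= i < n.+1) qint q i.

Definition qbinom (q n k : nat) : rat :=
  qfact q n / (qfact q k * qfact q (n - k)).

(* The poset L_n(F) of subspaces of F^n ordered by inclusion; [{vspace _}] has
   neither a finite nor an order structure in the library. *)
Definition subspaces (F : finFieldType) (n : nat) : Type := {vspace 'rV[F]_n}.

Fact poset_display : Order.disp_t. Proof. exact: Order.Disp tt tt. Qed.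

Section SubspacePoset.
Variables (F : finFieldType) (n : nat).
Local Notation L := (subspaces F n).

HB.instance Definition _ :=
  SubChoice.copy L {vspace 'rV[F]_n}.
HB.instance Definition _ := [Countable of L by <:].
HB.instance Definition _ := [Finite of L by <:].

Definition subspace_le : rel L := fun U V => (U <= V)%VS.

Fact subspace_le_refl : reflexive subspace_le.
Proof. by move=> U; apply: subvv. Qed.

Fact subspace_le_anti : antisymmetric subspace_le.
Proof. by move=> U V; apply: subv_anti. Qed.

Fact subspace_le_trans : transitive subspace_le.
Proof. by move=> V U W; apply: subv_trans. Qed.

HB.instance Definition _ := Order.Le_isPOrder.Build poset_display L
  subspace_le_refl subspace_le_anti subspace_le_trans.

Definition level (k : nat) : {set L} := [set U : L | \dim U == k].

End SubspacePoset.

(* In each of the next two posets the element a_i is the constructor applied to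
   [i : 'I_3]. *)
Variant wedge_elt := Wedge of 'I_3.

Section WedgePoset.

Definition wedge_val (x : wedge_elt) : 'I_3 := let: Wedge i := x in i.

HB.instance Definition _ := [isNew for wedge_val].
HB.instance Definition _ := [Finite of wedge_elt by <:].

Definition wedge_le : rel wedge_elt := fun x y => (x == y) || (y == Wedge ord0).

Fact wedge_le_refl : reflexive wedge_le.
Proof. by move=> x; rewrite /wedge_le eqxx. Qed.

Fact wedge_le_anti : antisymmetric wedge_le.
Proof.
move=> x y; rewrite /wedge_le [y == x]eq_sym.
by case: (x =P y) => //= _ /andP[/eqP-> /eqP->].
Qed.

Fact wedge_le_trans : transitive wedge_le.
Proof.
move=> y x z; rewrite /wedge_le.
case: (x =P y) => [->|_] //= /eqP->; case: (_ =P z) => [<-|_] /=;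
  by rewrite ?eqxx ?orbT //= => ->; rewrite orbT.
Qed.

HB.instance Definition _ := Order.Le_isPOrder.Build poset_display wedge_elt
  wedge_le_refl wedge_le_anti wedge_le_trans.

End WedgePoset.

Definition wedge : finPOrderType poset_display := wedge_elt.

Variant vee_elt := Vee of 'I_3.

Section VeePoset.

Definition vee_val (x : vee_elt) : 'I_3 := let: Vee i := x in i.

HB.instance Definition _ := [isNew for vee_val].
HB.instance Definition _ := [Finite of vee_elt by <:].

Definition vee_le : rel vee_elt := fun x y => (x == y) || (x == Vee ord0).

Fact vee_le_refl : reflexive vee_le.
Proof. by move=> x; rewrite /vee_le eqxx. Qed.

Fact vee_le_anti : antisymmetric vee_le.
Proof.
move=> x y; rewrite /vee_le [y == x]eq_sym.
by case: (x =P y) => //= _ /andP[/eqP-> /eqP->].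
Qed.

Fact vee_le_trans : transitive vee_le.
Proof.
move=> y x z; rewrite /vee_le.
case: (x =P y) => [->|_] //= /eqP->; case: (_ =P z) => [<-|_] /=;
  by rewrite ?eqxx ?orbT //= => ->; rewrite orbT.
Qed.

HB.instance Definition _ := Order.Le_isPOrder.Build poset_display vee_elt
  vee_le_refl vee_le_anti vee_le_trans.

End VeePoset.

Definition vee : finPOrderType poset_display := vee_elt.

Section Containment.
Variables (d d' : Order.disp_t) (P : finPOrderType d).

(* Weak (not necessarily induced) containment of [Q] in [A], ordered as in [P]. *)
Definition contains (Q : finPOrderType d') (A : {set P}) : bool :=
  [exists theta : {ffun Q -> P},
    [&& injectiveb theta, [forall x, theta x \in A] &
        [forall x, forall y, (x <= y)%O ==> (theta x <= theta y)%O]]].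

Definition contains_none (Qs : seq (finPOrderType d')) (A : {set P}) : bool :=
  all (fun Q => ~~ contains Q A) Qs.

Definition extremal (Qs : seq (finPOrderType d')) : nat :=
  (\max_(A : {set P} | contains_none Qs A) #|A|)%N.

End Containment.

Arguments extremal {d d'} P Qs.

Section FanoConfigurations.
Variables (F : finFieldType) (n : nat).
Local Notation L := (subspaces F n).

Definition points_and_lines (A : {set L}) : Prop :=
  exists S : {set L},
    [/\ S \subset level F n 1, #|S| = 3%N,
        ~ (exists2 W : L, W \in level F n 2 & {in S, forall U, (U <= W)%O}) &
        A = S :|: [set W in level F n 2 | #|[set U in S | (U <= W)%O]| <= 1]%N].

Definition lines_and_points (A : {set L}) : Prop :=
  exists S : {set L},
    [/\ S \subset level F n 2, #|S| = 3%N,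
        ~ (exists2 U : L, U \in level F n 1 & {in S, forall W, (U <= W)%O}) &
        A = S :|: [set U in level F n 1 | #|[set W in S | (U <= W)%O]| <= 1]%N].

Definition fano_config (i : 'I_4) (A : {set L}) : Prop :=
  match val i with
  | 0 => A = level F n 1
  | 1 => A = level F n 2
  | 2 => points_and_lines A
  | _ => lines_and_points A
  end.

End FanoConfigurations.

(* Main.v *)
(* Write [A] for a family without a wedge or a vee: every member of [A] is
   comparable to at most one other member.  In a family of maximum size, the
   members of the top dimension [t] can be replaced by those of their
   hyperplanes that contain no smaller member of [A]; if [2 (t - 1) >= n] this
   makes the family larger, so by this and its dual a maximum family lies in the
   middle level(s).

   For odd [n = 2 m + 1] and each subspace [B] of dimension [m - 1], the members
   of dimensions [m] and [m + 1] over [B] are points and lines of a projective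
   space, and the incidence between them is a matching.  Counting pairs of
   chosen points on lines (Cauchy-Schwarz) when there are few points, and pairs
   of unchosen points when there are many, bounds the sum of the two densities
   by 1, strictly unless all points or none are chosen.  Averaging over [B] gives
   the bound, and connectedness of the level gives the uniqueness.  Only the
   Fano plane escapes the strict inequality; there the equality case of
   Cauchy-Schwarz leaves the triangles as the only further possibility. *)
Require Import Defs.
From mathcomp Require Import all_boot all_order all_algebra finfield.
From mathcomp Require Import zify ring.

Set Implicit Arguments.
Unset Strict Implicit.
Unset Printing Implicit Defensive.

Import Order.TTheory GRing.Theory Num.Theory VectorInternalTheory.

(** * Subspaces over a finite field *)

Definition qnat (q k : nat) : nat := \sum_(i < k) q ^ i.

Lemma qnatS q k : qnat q k.+1 = qnat q k + q ^ k.
Proof. by rewrite /qnat big_ord_recr. Qed.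

Lemma qnatSl q k : qnat q k.+1 = (q * qnat q k).+1.
Proof.
by rewrite /qnat big_ord_recl big_distrr /= add1n; congr _.+1; apply: eq_bigr => i _; rewrite expnS.
Qed.

Lemma qnatE q k : q.-1 * qnat q k = (q ^ k).-1.
Proof. by rewrite /qnat -predn_exp. Qed.

(** Follows from [qnatE] because [q.-1] is positive. This is the strict gain in [shift_down]. *)
Lemma qnat_lt_exp q k : 1 < q -> qnat q k < q ^ k.
Proof.
move=> q1; have := qnatE q k; have := expn_gt0 q k; case: (qnat q k) => [|x]; first lia.
move=> _; nia.
Qed.

Lemma leq_qnat q j k : j <= k -> qnat q j <= qnat q k.
Proof.
move=> /subnKC <-; elim: (k - j) => [|i IH]; rewrite ?addn0 // addnS qnatS.
exact: leq_trans IH (leq_addr _ _).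
Qed.

Section Subspaces.
Variables (F : finFieldType) (n : nat).
Local Notation q := #|F|.
Local Notation L := (subspaces F n).
Implicit Types U V W Z : L.

Lemma card_field_gt1 : 1 < q.
Proof.
have /subset_leq_card := subsetT [set (0 : F)%R; 1%R].
by rewrite cards2 eq_sym oner_eq0 cardsT.
Qed.

Lemma card_subspace (U : {vspace 'rV[F]_n}) : #|[set v | v \in U]| = q ^ \dim U.
Proof. by rewrite cardsE; apply: card_vspace. Qed.

Lemma card_subspaceD U V : (U <= V)%VS ->
  #|[set v | (v \in V) && (v \notin U)]| = q ^ \dim V - q ^ \dim U.
Proof.
move=> sUV; rewrite -!card_subspace -(setIidPr (_ : [set v | v \in U] \subset [set v | v \in V])).
  by rewrite -cardsD; apply: eq_card => v; rewrite !inE andbC.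
by apply/subsetP=> v; rewrite !inE; apply: subvP.
Qed.

Lemma dim_add_vector U (v : 'rV[F]_n) : v \notin U -> \dim (U + <[v]>)%VS = (\dim U).+1.
Proof.
move=> vU; rewrite dimv_disjoint_sum; last first.
  apply/eqP; rewrite -subv0; apply/subvP=> w; rewrite memv_cap => /andP[wU /vlineP[k wk]].
  have [k0|k0] := eqVneq k 0%R; first by rewrite wk k0 scale0r mem0v.
  by case/negP: vU; rewrite -[v](scalerK k0) -wk memvZ.
rewrite dim_vline; case: eqP vU => [->|_ _]; first by rewrite mem0v.
by rewrite addn1.
Qed.

Definition above U Z : {set L} :=
  [set W : L | [&& (U <= W)%VS, (W <= Z)%VS & \dim W == (\dim U).+1]].

(** Each vector [v] of [Z] outside [U] gives the space [U + <[v]>], and those giving [W] are the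
    vectors of [W] outside [U]. *)
Lemma card_above U Z : (U <= Z)%VS -> #|above U Z| = qnat q (\dim Z - \dim U).
Proof.
move=> sUZ.
have q1 := card_field_gt1.
have dUZ := dimvS sUZ.
pose Q := [set v : 'rV[F]_n | (v \in Z) && (v \notin U)].
pose f (v : 'rV[F]_n) : L := (U + <[v]>)%VS.
have fQ v : v \in Q -> f v \in above U Z.
  rewrite !inE => /andP[vZ vU]; rewrite addvSl dim_add_vector // eqxx andbT.
  by rewrite subv_add sUZ -memvE.
have E : #|Q| = #|above U Z| * (q ^ (\dim U).+1 - q ^ \dim U).
  rewrite -sum1_card (partition_big f (mem (above U Z)) fQ) /= -sum_nat_const.
  apply: eq_bigr => W; rewrite inE => /and3P[sUW sWZ /eqP dW].
  rewrite -dW -card_subspaceD // -sum1_card; apply: eq_bigl => v; rewrite !inE.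
  apply/idP/idP=> [/andP[/andP[_ vU] /eqP <-]|/andP[vW vU]].
    by rewrite vU andbT memvE addvSr.
  rewrite (subvP sWZ) // vU /= eqEdim dim_add_vector // dW leqnn andbT.
  by rewrite subv_add sUW -memvE.
rewrite /Q card_subspaceD // in E.
have q0 : 0 < q ^ \dim U by rewrite expn_gt0 (ltnW q1).
have := qnatE q (\dim Z - \dim U); move: E.
rewrite -{1}(subnKC dUZ) expnD expnS; set k := \dim Z - \dim U => E.
have qk : 0 < q ^ k by rewrite expn_gt0 (ltnW q1).
move=> E2; have q1' : 0 < q.-1 by lia.
apply/eqP; rewrite -(eqn_pmul2l q1') E2 -(eqn_pmul2r q0); apply/eqP.
move: E; nia.
Qed.

(** The orthogonal complement for the standard dot product; it supplies the order-reversing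
    involution used for duality. *)
Definition perp U : L := mx2vs (kermx (vs2mx U)^T).

Lemma dim_perp U : \dim (perp U) = n - \dim U.
Proof.
(* The dimension of ['rV[F]_n] is recorded as [1 * n]. *)
by rewrite /dimv mx2vsK mxrank_ker mxrank_tr; congr (_ - _); apply: mul1n.
Qed.

Lemma dim_le U : \dim U <= n.
Proof. by rewrite -[n in _ <= n]mul1n; have := dimvS (subvf U); rewrite dimvf. Qed.

Lemma perpS U V : (U <= V)%VS -> (perp V <= perp U)%VS.
Proof.
rewrite /subsetv !mx2vsK => /submxP[D ->]; apply/sub_kermxP.
by rewrite trmx_mul mulmxA mulmx_ker mul0mx.
Qed.

Lemma perpK : involutive perp.
Proof.
move=> U; apply/eqP; rewrite eq_sym eqEdim !dim_perp subKn ?dim_le // leqnn andbT.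
rewrite /subsetv mx2vsK; apply/sub_kermxP; apply: trmx_inj; rewrite trmx_mul trmxK trmx0.
by apply/sub_kermxP; rewrite mx2vsK.
Qed.

Lemma perp_inj : injective perp. Proof. exact: inv_inj perpK. Qed.

Lemma perp_le U V : (perp U <= perp V)%VS = (V <= U)%VS.
Proof. by apply/idP/idP => /perpS; rewrite ?perpK. Qed.

Definition below U Z : {set L} :=
  [set W : L | [&& (U <= W)%VS, (W <= Z)%VS & (\dim W).+1 == \dim Z]].

Lemma card_below U Z : (U <= Z)%VS -> #|below U Z| = qnat q (\dim Z - \dim U).
Proof.
move=> sUZ; have dU := dim_le Z; have := dimvS sUZ.
rewrite -(card_imset _ perp_inj) => dUZ.
transitivity #|above (perp Z) (perp U)|; last first.
  rewrite card_above ?perp_le // !dim_perp; congr qnat; lia.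
apply: eq_card => W; rewrite -[W]perpK (mem_imset _ _ perp_inj) !inE !perp_le !dim_perp.
have := dim_le (perp W); rewrite dim_perp.
rewrite andbCA => _; do 2! congr (_ && _); apply/eqP/eqP; have := dim_le W; lia.
Qed.
End Subspaces.

(** * Gaussian binomials *)

Lemma double_count (T1 T2 : finType) (A : {set T1}) (B : {set T2}) (R : T1 -> T2 -> bool) :
  \sum_(x in A) #|[set y in B | R x y]| = \sum_(y in B) #|[set x in A | R x y]|.
Proof.
under eq_bigr do rewrite -sum1_card.
under [RHS]eq_bigr do rewrite -sum1_card.
rewrite (exchange_big_dep (mem B)) /= => [|x y _]; last by rewrite inE => /andP[].
by apply: eq_bigr => y yB; apply: eq_bigl => x; rewrite !inE yB.
Qed.

Section Levels.
Variables (F : finFieldType) (n : nat).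
Local Notation q := #|F|.
Local Notation L := (subspaces F n).
Implicit Types U V W Z : L.

Lemma mem_level k U : (U \in level F n k) = (\dim U == k).
Proof. by rewrite inE. Qed.

Lemma card_level_above k U : \dim U = k ->
  #|[set W in level F n k.+1 | (U <= W)%VS]| = qnat q (n - k).
Proof.
move=> dU; have -> : n - k = \dim (fullv : L) - \dim U.
  by rewrite dU dimvf; congr (_ - _); symmetry; apply: mul1n.
rewrite -card_above ?subvf //; apply: eq_card => W; rewrite !inE subvf dU.
by rewrite andbC.
Qed.

Lemma card_level_below k U : \dim U = k.+1 ->
  #|[set W in level F n k | (W <= U)%VS]| = qnat q k.+1.
Proof.
move=> dU; have -> : k.+1 = \dim U - \dim (0%VS : L) by rewrite dimv0 subn0.
rewrite -card_below ?sub0v //.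
by apply: eq_card => W; rewrite !inE sub0v dU eqSS andbC.
Qed.

(** Counts the incident pairs of two consecutive levels in two ways; this is the recursion in [k]
    behind [card_level]. *)
Lemma level_incidence k :
  #|level F n k| * qnat q (n - k) = #|level F n k.+1| * qnat q k.+1.
Proof.
rewrite -!sum_nat_const.
transitivity (\sum_(U in level F n k) #|[set W in level F n k.+1 | (U <= W)%VS]|).
  by apply: eq_bigr => U; rewrite mem_level => /eqP /card_level_above.
rewrite double_count; apply: eq_bigr => W; rewrite mem_level => /eqP /card_level_below //.
Qed.

Lemma card_level0 : #|level F n 0| = 1.
Proof.
rewrite -(cards1 (0%VS : L)); apply: eq_card => U; rewrite !inE.
by rewrite dimv_eq0.
Qed.

Lemma qint_nat k : qint q k = ((qnat q k)%:R)%R.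
Proof.
have q1 := card_field_gt1 F; rewrite /qint -natrX.
have -> : ((q ^ k)%:R - 1 = (q%:R - 1) * (qnat q k)%:R :> rat)%R.
  rewrite -(@natrB _ _ 1) ?expn_gt0 ?(ltnW q1) // -(@natrB _ _ 1) ?(ltnW q1) //.
  by rewrite -natrM !subn1 -qnatE.
rewrite mulrC mulKf // subr_eq0 pnatr_eq1.
by rewrite neq_ltn q1 orbT.
Qed.

Lemma qnat_gt0 k : 0 < qnat q k.+1.
Proof. by rewrite qnatSl. Qed.

Lemma qfact0 : qfact q 0 = 1%R. Proof. by rewrite /qfact big_geq. Qed.

Lemma qfactS k : qfact q k.+1 = (qfact q k * (qnat q k.+1)%:R)%R.
Proof. by rewrite /qfact big_nat_recr //= qint_nat. Qed.

Lemma qfact_neq0 k : qfact q k != 0%R.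
Proof.
elim: k => [|k IH]; first by rewrite qfact0 oner_eq0.
by rewrite qfactS mulf_neq0 // pnatr_eq0 -lt0n qnat_gt0.
Qed.

Lemma card_level k : k <= n -> (#|level F n k|%:R)%R = qbinom q n k.
Proof.
elim: k => [|k IH] kn.
  rewrite card_level0 /qbinom subn0 qfact0 mul1r divff //.
  exact: qfact_neq0.
have K0 : ((qnat q k.+1)%:R != 0 :> rat)%R by rewrite pnatr_eq0 -lt0n qnat_gt0.
apply: (mulIf K0); rewrite -natrM -level_incidence natrM IH ?(ltnW kn) //.
rewrite /qbinom qfactS subnS; have: 0 < n - k by lia.
case: (n - k) => //= j _; rewrite qfactS.
have := (qfact_neq0 k, qfact_neq0 j); case=> Hk Hj.
have J0 : ((qnat q j.+1)%:R != 0 :> rat)%R by rewrite pnatr_eq0 -lt0n qnat_gt0.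
field; rewrite /= Hk Hj K0 J0 //.
Qed.

Lemma card_level_sym k : k <= n -> #|level F n (n - k)| = #|level F n k|.
Proof.
move=> kn; rewrite -(card_imset _ (@perp_inj F n)); apply: eq_card => U.
rewrite -[U]perpK (mem_imset _ _ (@perp_inj F n)) !mem_level dim_perp.
rewrite perpK; apply/eqP/eqP; have := dim_le U; lia.
Qed.
End Levels.

(** * Families without a wedge or a vee *)

Section Free.
Variables (d : Order.disp_t) (P : finPOrderType d).
Implicit Types (A : {set P}) (x y z : P).

(* Equivalent to the absence of a wedge and a vee, because a chain of three
   contains both; see [freeP]. *)
Definition wv_free A : Prop := forall x y z, x \in A -> y \in A -> z \in A ->
  y != x -> z != x -> (x >=< y)%O -> (x >=< z)%O -> y = z.

Definition triple x y z (i : 'I_3) : P := nth x [:: x; y; z] i.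

Lemma triple_inj x y z : x != y -> x != z -> y != z -> injective (triple x y z).
Proof.
move=> xy xz yz i j /eqP; rewrite nth_uniq ?ltn_ord //= => [/eqP/val_inj //|].
by rewrite !inE negb_or xy xz yz.
Qed.

Lemma triple_mem A x y z i : x \in A -> y \in A -> z \in A -> triple x y z i \in A.
Proof. by case: i => [[|[|[|//]]] Hi] /=. Qed.

Lemma contains_wedge A x y z : x \in A -> y \in A -> z \in A ->
  y != x -> z != x -> y != z -> (y <= x)%O -> (z <= x)%O -> contains wedge A.
Proof.
move=> xA yA zA yx zx yz ley lez; apply/existsP.
exists [ffun w : wedge_elt => triple x y z (wedge_val w)]; apply/and3P; split.
- apply/injectiveP=> w w'; rewrite !ffunE => /triple_inj E.
  by apply: val_inj; apply: E; rewrite // eq_sym.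
- by apply/forallP=> w; rewrite ffunE triple_mem.
apply/'forall_forallP => w w'; apply/implyP; rewrite !ffunE.
case/orP=> [/eqP-> //|/eqP->]; rewrite /triple /=.
by case: w => [[[|[|[|//]]] Hi]] /=.
Qed.

Lemma contains_vee A x y z : x \in A -> y \in A -> z \in A ->
  y != x -> z != x -> y != z -> (x <= y)%O -> (x <= z)%O -> contains vee A.
Proof.
move=> xA yA zA yx zx yz ley lez; apply/existsP.
exists [ffun w : vee_elt => triple x y z (vee_val w)]; apply/and3P; split.
- apply/injectiveP=> w w'; rewrite !ffunE => /triple_inj E.
  by apply: val_inj; apply: E; rewrite // eq_sym.
- by apply/forallP=> w; rewrite ffunE triple_mem.
apply/'forall_forallP => w w'; apply/implyP; rewrite !ffunE.
case/orP=> [/eqP-> //|/eqP->]; rewrite /triple /=.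
by case: w' => [[[|[|[|//]]] Hi]] /=.
Qed.

Lemma freeP A : reflect (wv_free A) (contains_none [:: wedge; vee] A).
Proof.
apply: (iffP idP) => [|fA].
  rewrite /contains_none /= andbT => /andP[nw nv] x y z xA yA zA yx zx cy cz.
  apply/eqP/negPn/negP=> yz; move: cy cz; rewrite /Order.comparable.
  have xy : x != y by rewrite eq_sym.
  have xz : x != z by rewrite eq_sym.
  have zy : z != y by rewrite eq_sym.
  case/orP=> ley; case/orP=> lez.
  - by case/negP: nv; apply: (@contains_vee A x y z).
  (* Here [z <= x <= y] is a chain, and its top [y] lies above the other two. *)
  - by case/negP: nw; apply: (@contains_wedge A y x z) => //; apply: le_trans ley.
  - by case/negP: nw; apply: (@contains_wedge A z x y) => //; apply: le_trans lez.
  - by case/negP: nw; apply: (@contains_wedge A x y z).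
rewrite /contains_none /= andbT; apply/andP; split;
  apply/negP=> /existsP[th /and3P[/injectiveP inj /forallP mem /'forall_forallP le]].
  have ne (i j : 'I_3) : i != j -> th (Wedge i) != th (Wedge j).
    by apply: contraNneq => /inj [->].
  have cmp i : (th (Wedge ord0) >=< th (Wedge i))%O.
    rewrite /Order.comparable; apply/orP; right.
    by apply: (implyP (le _ _)); rewrite /Order.le /= /wedge_le eqxx orbT.
  pose i1 : 'I_3 := inord 1; pose i2 : 'I_3 := inord 2.
  have [] : th (Wedge i1) != th (Wedge i2) /\ th (Wedge i1) = th (Wedge i2).
    split; first by apply: ne; rewrite -val_eqE /= !inordK.
    by apply: (fA (th (Wedge ord0))); rewrite ?mem ?ne ?cmp // -val_eqE /= !inordK.
  by move=> /eqP.
have ne (i j : 'I_3) : i != j -> th (Vee i) != th (Vee j).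
  by apply: contraNneq => /inj [->].
have cmp i : (th (Vee ord0) >=< th (Vee i))%O.
  rewrite /Order.comparable; apply/orP; left.
  by apply: (implyP (le _ _)); rewrite /Order.le /= /vee_le eqxx orbT.
pose i1 : 'I_3 := inord 1; pose i2 : 'I_3 := inord 2.
have [] : th (Vee i1) != th (Vee i2) /\ th (Vee i1) = th (Vee i2).
  split; first by apply: ne; rewrite -val_eqE /= !inordK.
  by apply: (fA (th (Vee ord0))); rewrite ?mem ?ne ?cmp // -val_eqE /= !inordK.
by move=> /eqP.
Qed.

Lemma antichain_wv_free A : {in A &, forall x y, (x <= y)%O -> x = y} -> wv_free A.
Proof.
move=> anti x y z xA yA zA /eqP yx _ /orP[] le; case: yx; first by symmetry; apply: anti.
by rewrite (anti y x).
Qed.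

(** Turns freeness into the degree bounds that make the incidence of two levels a matching. *)
Lemma wv_free_card_le1 A (S : {set P}) x : wv_free A -> x \in A -> S \subset A ->
  {in S, forall y, y != x /\ (x >=< y)%O} -> #|S| <= 1.
Proof.
move=> fA xA /subsetP SA H; rewrite leqNgt; apply/negP=> /card_gt1P[y [z [yS zS /eqP[]]]].
have [yx cy] := H _ yS; have [zx cz] := H _ zS.
by apply: (fA x) => //; apply: SA.
Qed.

End Free.

(** * Shifting towards the middle levels *)

Section Shift.
Variables (F : finFieldType) (n : nat).
Local Notation q := #|F|.
Local Notation L := (subspaces F n).
Local Notation wv_free := (@wv_free poset_display L).
Implicit Types (U V W Z : L) (A : {set L}).

Lemma level_antichain k : {in level F n k &, forall U V, (U <= V)%VS -> U = V}.
Proof.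
move=> U V; rewrite !mem_level => /eqP dU /eqP dV le.
by apply/eqP; rewrite eqEdim le dU dV leqnn.
Qed.

Lemma level_wv_free k : wv_free (level F n k).
Proof. by apply: antichain_wv_free; apply: level_antichain. Qed.

(* The top level [T] of [A] is replaced by the hyperplanes of members of [T] that
   contain no member of [A] outside [T].  A member of [T] contains at most one
   such member, and it is nonzero, so at least [q ^ s] of its hyperplanes
   survive, while each hyperplane lies in [qnat q (n - s) < q ^ s] spaces of
   dimension [s.+1]. *)
Lemma shift_down A s : wv_free A -> (0%VS : L) \notin A ->
  {in A, forall U, \dim U <= s.+1} -> n <= 2 * s -> (exists2 U, U \in A & \dim U = s.+1) ->
  exists2 A', wv_free A' & #|A| < #|A'|.
Proof.
move=> fA A0 dA ns [U0 U0A dU0].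
have q1 := card_field_gt1 F.
pose T := A :&: level F n s.+1; pose R := A :\: T.
have memR U : (U \in R) = (U \in A) && (\dim U <= s).
  rewrite !inE; case UA: (U \in A); rewrite ?andbF //=.
  by have := dA _ UA; lia.
pose D : {set L} := 
    [set S in level F n s |
       [exists u in T, (S <= u)%VS] && [forall v in R, ~~ (v <= S)%VS]].
have DR : [disjoint R & D].
  rewrite disjoint_subset; apply/subsetP=> S SR; rewrite !inE !negb_and.
  apply/orP; right; apply/orP; right; rewrite negb_forall_in.
  by apply/existsP; exists S; rewrite SR subvv.
have TD : #|T| < #|D|.
  have B1 : \sum_(u in T) #|[set S in D | (S <= u)%VS]| <= #|D| * qnat q (n - s).
    rewrite double_count -sum_nat_const; apply: leq_sum => S.
    rewrite inE mem_level => /andP[/eqP dS _]; rewrite -(card_level_above dS) //.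
    by apply/subset_leq_card/subsetP=> u; rewrite !inE -andbA => /andP[_].
  have B2 : #|T| * q ^ s <= \sum_(u in T) #|[set S in D | (S <= u)%VS]|.
    rewrite -sum_nat_const; apply: leq_sum => u; rewrite inE mem_level => /andP[uA /eqP du].
    pose H := [set S in level F n s | (S <= u)%VS].
    pose Bad := [set S in H | [exists v in R, (v <= S)%VS]].
    have BH : Bad \subset H by apply/subsetP=> S; rewrite inE => /andP[].
    (* By freeness [u] contains only one member [v] of [R], so every bad hyperplane lies between [v]
       and [u]; as [v] is nonzero, at most [[s]] are bad. *)
    have cB : #|Bad| <= qnat q s.
      have [->|[S1]] := set_0Vmem Bad; first by rewrite cards0.
      rewrite inE => /andP[S1H /exists_inP[v vR vS1]].
      have vu S w : S \in H -> w \in R -> (w <= S)%VS -> w != u /\ (u >=< w)%O.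
        move=> SH wR wS; move: SH; rewrite !inE => /andP[/eqP dS Su]; split.
          by apply: contraTneq wR => ->; rewrite memR uA du ltnn.
        by rewrite /Order.comparable; apply/orP; right; apply: subv_trans Su.
      have RA w : w \in R -> w \in A by rewrite memR => /andP[].
      have [vu1 cvu] := vu _ _ S1H vR vS1.
      have v0 : 0 < \dim v.
        by rewrite lt0n dimv_eq0; apply: contraNneq A0 => <-; apply: RA.
      apply: (@leq_trans #|below v u|).
        apply/subset_leq_card/subsetP=> S; rewrite inE => /andP[SH /exists_inP[w wR wS]].
        have [wu cwu] := vu _ _ SH wR wS.
        have <- : w = v by apply: (fA u); rewrite ?(RA w) ?(RA v) //.
        by move: SH; rewrite !inE wS du eqSS => /andP[-> ->].
      rewrite card_below; last by move: S1H; rewrite inE => /andP[_]; apply: subv_trans.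
      by rewrite du; apply: leq_qnat; lia.
    have: H :\: Bad \subset [set S in D | (S <= u)%VS].
      apply/subsetP=> S; rewrite in_setD => /andP[nB SH].
      have {}nB : ~~ [exists v in R, (v <= S)%VS] by move: nB; rewrite inE SH.
      case/setIdP: SH => Ss Su; rewrite inE [S \in D]inE Su Ss andbT /=; apply/andP; split.
        by apply/exists_inP; exists u => //; rewrite inE uA mem_level du /=.
      by rewrite -negb_exists_in.
    move/subset_leq_card; rewrite cardsD (setIidPr BH) (card_level_below du) qnatS.
    by apply: leq_trans; lia.
  have T0 : 0 < #|T| by apply/card_gt0P; exists U0; rewrite inE U0A mem_level dU0 /=.
  have B3 : qnat q (n - s) < q ^ s.
    by apply: leq_ltn_trans (qnat_lt_exp s q1); apply: leq_qnat; lia.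
  have := leq_trans B2 B1; nia.
exists (R :|: D); last first.
  rewrite cardsU disjoint_setI0 // cards0 subn0.
  by rewrite -(cardsID T A) (setIidPr (subsetIl _ _)) addnC ltn_add2l.
(* Members of [D] are incomparable to [R] and to one another, so only comparabilities inside [R]
   remain. *)
have RD x y : x \in R -> y \in D -> (x >=< y)%O = false.
  move=> xR; rewrite inE mem_level => /and3P[/eqP dy _ /forall_inP/(_ x xR) nxy].
  rewrite /Order.comparable; apply/negP=> /orP[le|le]; first by rewrite [(x <= y)%VS]le in nxy.
  case/negP: nxy; suff -> : x = y by [].
  by apply/esym/eqP; rewrite eqEdim [(y <= x)%VS]le dy; move: xR; rewrite memR => /andP[].
have DD x y : x \in D -> y \in D -> y != x -> (x >=< y)%O = false.
  rewrite !inE => /andP[Hx _] /andP[Hy _] yx; rewrite /Order.comparable.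
  apply/negP=> /orP[] le; move/eqP: yx; case; first apply/esym.
    by apply: (@level_antichain s); rewrite ?inE.
  by apply: (@level_antichain s); rewrite ?inE.
move=> x y z; rewrite ![_ \in R :|: D]in_setU.
case/orP=> xR; case/orP=> yR; case/orP=> zR // yx zx;
  do ?[by rewrite RD | by rewrite (RD x z) | by rewrite DD
      | by rewrite comparable_sym RD | by move=> _; rewrite comparable_sym RD].
by apply: (fA x) => //; move: xR yR zR; rewrite !memR => /andP[? _] /andP[? _] /andP[? _].
Qed.
End Shift.

(** * Maximum families lie in the middle levels *)

Section Maximum.
Variables (F : finFieldType) (n : nat).
Local Notation q := #|F|.
Local Notation L := (subspaces F n).
Local Notation wv_free := (@wv_free poset_display L).
Implicit Types (U V W Z : L) (A : {set L}).

Definition maximum A : Prop := wv_free A /\ forall B, wv_free B -> #|B| <= #|A|.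

Lemma wv_free_perp A : wv_free A -> wv_free (perp (n:=n) @: A).
Proof.
move=> fA x y z /imsetP[x' xA ->] /imsetP[y' yA ->] /imsetP[z' zA ->].
rewrite !(inj_eq (@perp_inj F n)) => yx zx cy cz; congr perp.
apply: (fA x') => //; rewrite /Order.comparable.
  by rewrite orbC; move: cy; rewrite /Order.comparable /Order.le /= /subspace_le !perp_le.
by rewrite orbC; move: cz; rewrite /Order.comparable /Order.le /= /subspace_le !perp_le.
Qed.

Lemma maximum_perp A : maximum A -> maximum (perp (n:=n) @: A).
Proof.
case=> fA mA; split; first exact: wv_free_perp.
by move=> B /mA; rewrite (card_imset _ (@perp_inj F n)).
Qed.

Lemma card_level1 : #|level F n 1| = qnat q n.
Proof.
have := level_incidence F n 0; rewrite card_level0 mul1n subn0 => ->.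
by rewrite /qnat big_ord1 muln1.
Qed.

(** Zero is comparable to everything, so a free family containing it has at most two members, while
    there are at least [[2] = q + 1 >= 3] points. *)
Lemma maximum_not0 A : 2 <= n -> maximum A -> (0%VS : L) \notin A.
Proof.
move=> n2 [fA mA]; apply/negP=> A0.
have c3 : 3 <= #|A|.
  apply: leq_trans (mA _ (@level_wv_free F n 1)); rewrite card_level1.
  apply: leq_trans (leq_qnat _ n2); rewrite qnatSl /qnat big_ord1 muln1 ltnS.
  exact: card_field_gt1.
have := cardsD1 (0%VS : L) A; rewrite A0 => cA.
have /card_gt1P[x [y [xA yA xy]]] : 1 < #|A :\ (0%VS : L)| by move: c3; rewrite cA.
case/setD1P: xA => x0 xA; case/setD1P: yA => y0 yA; case/eqP: xy.
by apply: (fA 0%VS); rewrite // /Order.comparable /Order.le /= /subspace_le sub0v.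
Qed.

(** If a member [V] of top dimension had [2 * \dim V >= n + 2], then [shift_down] with
    [s = \dim V - 1] would enlarge [A]. *)
Lemma maximum_dim_le A : 2 <= n -> maximum A -> {in A, forall U, 2 * \dim U <= n.+1}.
Proof.
move=> n2 mA U UA.
have A0 := maximum_not0 n2 mA; case: mA => fA mA.
have [V VA maxV] : exists2 V, V \in A & {in A, forall W, \dim W <= \dim V}.
  by exists [arg max_(V > U in A) \dim V]; case: arg_maxnP.
apply: leq_trans (_ : 2 * \dim V <= _); first by rewrite leq_mul2l maxV.
rewrite leqNgt; apply/negP=> big.
have V0 : 0 < \dim V by lia.
have [|||A' fA'] := @shift_down F n A (\dim V).-1 fA A0; rewrite ?prednK //.
- by lia.
- by exists V.
by rewrite ltnNge mA.
Qed.

Lemma maximum_dim_ge A : 2 <= n -> maximum A -> {in A, forall U, n <= (2 * \dim U).+1}.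
Proof.
move=> n2 mA U UA; have := maximum_dim_le n2 (maximum_perp mA) (imset_f _ UA).
by rewrite dim_perp; have := dim_le U; lia.
Qed.

Lemma maximum_even A m : 2 <= n -> n = 2 * m -> maximum A -> A = level F n m.
Proof.
move=> n2 nm mA; have [fA maxA] := mA; apply/eqP; rewrite eqEcard maxA ?andbT; last exact: level_wv_free.
apply/subsetP=> U UA; rewrite mem_level.
by have := maximum_dim_le n2 mA UA; have := maximum_dim_ge n2 mA UA; lia.
Qed.

Lemma exists_maximum : exists A, maximum A.
Proof.
have f0 : contains_none [:: wedge; vee] (set0 : {set L}).
  by apply/freeP => x y z; rewrite inE.
exists [arg max_(A > (set0 : {set L}) | contains_none [:: wedge; vee] A) #|A|].
case: arg_maxnP => //= A /freeP fA mA; split=> // B fB; apply: mA.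
by apply/freeP.
Qed.

Lemma extremal_maximum A : maximum A -> extremal L [:: wedge; vee] = #|A|.
Proof.
case=> fA mA; apply/eqP; rewrite eqn_leq; apply/andP; split.
  by apply/bigmax_leqP=> B /freeP; apply: mA.
rewrite /extremal (bigD1 A) /=; [exact: leq_maxl|exact/freeP].
Qed.

End Maximum.

(** * Matchings in designs *)

(** After doubling, both sides are double sums, compared termwise by
    [2 * x * y <= x ^ 2 + y ^ 2]. *)
Lemma cauchy_schwarz_nat (T : finType) (C : {set T}) (f : T -> nat) :
  (\sum_(i in C) f i) ^ 2 <= #|C| * \sum_(i in C) f i ^ 2.
Proof.
rewrite -(leq_pmul2l (isT : 0 < 2)).
have -> : 2 * (#|C| * \sum_(i in C) f i ^ 2) = \sum_(i in C) \sum_(j in C) (f i ^ 2 + f j ^ 2).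
  under [RHS]eq_bigr do rewrite big_split sum_nat_const /=.
  by rewrite big_split sum_nat_const -big_distrr /=; lia.
rewrite -mulnn big_distrl big_distrr /=; apply: leq_sum => i _.
rewrite !big_distrr /=; apply: leq_sum => j _.
by have [] := nat_Cauchy (f i) (f j).
Qed.

(** Here [a] counts chosen points, [c] unchosen lines and [p] chosen incident pairs; [S1] and [S2]
    are the first two moments of the degrees on unchosen lines. The conclusion says that unchosen
    lines are denser than chosen points. *)
Lemma matching_arith a c p q r S1 S2 : 0 < a -> 1 < q -> 2 * q.+1 <= r * q.-1 ->
  a * q.+1 <= 2 * q * r -> p <= a -> S1 + p = a * r -> S2 + p = a * (a.-1 + r) ->
  S1 ^ 2 <= c * S2 -> a * r < c * q.+1.
Proof.
case: a => // a _; case: q => [|[|q]] // _; case: r => // s /= rq aq pa E1 E2.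
have s2 : 2 <= s by case: s rq {aq E1 E2} => [|[|s]]; lia.
(* Now [q.+2], [s.+1] and [a.+1] replace [q], [r] and [a]; [t] counts the unmatched chosen
   points. *)
have [t Et] : exists t, a.+1 = p + t by exists (a.+1 - p); lia.
have -> : S1 = a.+1 * s + t by lia.
have -> : S2 = a.+1 * (a + s) + t by lia.
rewrite -mulnn => CS.
(* This settles [t = 0], where Cauchy-Schwarz and the negated goal give the reverse inequality; the
   terms in [t] are compared separately below. *)
have key : s.+1 * (a + s) < q.+3 * (s * s).
  have : q.+3 * (s.+1 * (a + s)) < q.+3 * (q.+3 * (s * s)).
    have h1 : s.+1 * (a.+1 * q.+3) <= s.+1 * (2 * q.+2 * s.+1) by rewrite leq_mul2l aq orbT.
    have h2 : q.+2 * s * (2 * q.+3) <= q.+2 * s * (s.+1 * q.+1) by rewrite leq_mul2l rq orbT.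
    have h3 : q.+2 * q.+1 * 2 <= q.+2 * q.+1 * s by rewrite leq_mul2l s2 orbT.
    lia.
  by rewrite ltn_mul2l => /andP[].
rewrite ltnNge; apply/negP=> bad.
have := leq_mul (leqnn (a.+1 * (a + s) + t)) bad.
have := leq_mul CS (leqnn q.+3).
have : a.+1 * a.+1 * (s.+1 * (a + s)) < a.+1 * a.+1 * (q.+3 * (s * s)) by rewrite ltn_mul2l key.
have : a.+1 * t * s.+1 <= a.+1 * t * (2 * s * q.+3).
  by rewrite leq_mul2l; apply/orP; right; have := leq_mul (leqnn (2 * s)) (isT : 1 <= q.+3); lia.
lia.
Qed.

Section Design.
Variables (T1 T2 : finType) (P : {set T1}) (L : {set T2}) (I : T1 -> T2 -> bool) (q r : nat).
Implicit Types (S X : {set T1}) (Y : {set T2}).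

Definition deg S y := #|[set x in S | I x y]|.

(** A Steiner system with blocks of size [q.+1] and replication number [r]; [q] need not be a field
    order here. *)
Record design : Prop := Design {
  design_rep : {in P, forall x, #|[set y in L | I x y]| = r};
  design_line : {in L, forall y, deg P y = q.+1};
  design_join : {in P &, forall x x', x != x' -> #|[set y in L | I x y && I x' y]| = 1} }.

Hypothesis D : design.

Lemma sum_deg S : S \subset P -> \sum_(y in L) deg S y = #|S| * r.
Proof.
move=> /subsetP sSP; rewrite -double_count -sum_nat_const; apply: eq_bigr => x xS.
by rewrite (design_rep D) ?sSP.
Qed.

(** The point [x] is counted on each of its [r] lines, every other point of [S] on exactly one of
    them. *)
Lemma sum_deg_at S x : S \subset P -> x \in S ->
  \sum_(y in [set y in L | I x y]) deg S y = #|S|.-1 + r.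
Proof.
move=> /subsetP sSP xS.
rewrite -double_count (bigD1 x) //= addnC; congr (_ + _); last first.
  by rewrite -(design_rep D (sSP _ xS)); apply: eq_card => y; rewrite !inE -andbA andbb.
rewrite (cardsD1 x) xS /= -sum1_card; apply: eq_big => [z|z /andP[zS zx]].
  by rewrite !inE andbC.
rewrite -(design_join D (sSP _ xS) (sSP _ zS)) 1?eq_sym //.
by apply: eq_card => y; rewrite !inE -andbA.
Qed.

(** The square [deg S y ^ 2] counts ordered pairs of points of [S] on [y]; sorting them by the first
    point reduces to [sum_deg_at]. *)
Lemma sum_deg_sq S : S \subset P -> \sum_(y in L) deg S y ^ 2 = #|S| * (#|S|.-1 + r).
Proof.
move=> sSP; rewrite -sum_nat_const.
transitivity (\sum_(x in S) \sum_(y in [set y in L | I x y]) deg S y).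
  rewrite (exchange_big_dep (mem L)) /= => [|x y _]; last by rewrite inE => /andP[].
  apply: eq_bigr => y yL; rewrite -mulnn -sum_nat_const; apply: eq_bigl => x.
  by rewrite !inE yL.
by apply: eq_bigr => x xS; apply: sum_deg_at.
Qed.

Lemma design_card_points x : x \in P -> #|P| = (q * r).+1.
Proof.
move=> xP; have P0 : 0 < #|P| by apply/card_gt0P; exists x.
rewrite -(prednK P0); congr _.+1; have := sum_deg_at (subxx P) xP.
rewrite (eq_bigr (fun=> q.+1)) => [|y]; last by rewrite inE => /andP[yL _]; apply: (design_line D).
rewrite sum_nat_const (design_rep D) //; lia.
Qed.

Lemma design_card_lines : #|L| * q.+1 = #|P| * r.
Proof.
by rewrite -(sum_deg (subxx P)) -sum_nat_const; apply: eq_bigr => y /(design_line D).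
Qed.

Variables (X : {set T1}) (Y : {set T2}).
Hypotheses (sXP : X \subset P) (sYL : Y \subset L).
Hypothesis degX : {in Y, forall y, deg X y <= 1}.
Hypothesis degY : {in X, forall x, #|[set y in Y | I x y]| <= 1}.

(* [p] is the number of incident pairs in [X * Y]. *)
Lemma matching_sums : exists p, [/\ p <= #|X|, p <= #|Y|,
  \sum_(y in L :\: Y) deg X y + p = #|X| * r &
  \sum_(y in L :\: Y) deg X y ^ 2 + p = #|X| * (#|X|.-1 + r)].
Proof.
exists (\sum_(y in Y) deg X y); split.
- rewrite -double_count -[leqRHS]muln1 -sum_nat_const; exact: leq_sum.
- rewrite -[leqRHS]muln1 -sum_nat_const; exact: leq_sum.
- by rewrite -(sum_deg sXP) [RHS](big_setID Y) /= (setIidPr sYL) addnC.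
rewrite -(sum_deg_sq sXP) [RHS](big_setID Y) /= (setIidPr sYL) addnC; congr (_ + _).
(* Degrees on [Y] are 0 or 1, hence equal to their squares, so the same [p] serves both moments. *)
by apply: eq_bigr => y /degX; case: (deg X y) => [|[|]].
Qed.

(* A line of [Y] contains at least [q] points outside [X], and two points share
   only one line. *)
Lemma matching_lines_bound : 0 < q -> #|Y| * (q * q.-1) <= #|P :\: X| * #|P :\: X|.-1.
Proof.
move=> q0; have sE : P :\: X \subset P by apply: subsetDl.
have S1 := sum_deg sE; have S2 := sum_deg_sq sE.
have : \sum_(y in L) deg (P :\: X) y * (deg (P :\: X) y).-1 = #|P :\: X| * #|P :\: X|.-1.
  apply: (@addIn (#|P :\: X| * r)); rewrite -mulnDr -S2 -S1 -big_split /=.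
  by apply: eq_bigr => y _; case: (deg _ y) => // m; nia.
move=> <-; rewrite -sum_nat_const [leqRHS](big_setID Y) /= (setIidPr sYL).
apply: leq_trans (leq_addr _ _); apply: leq_sum => y yY.
have := degX yY; have := design_line D (subsetP sYL _ yY).
have -> : deg P y = deg X y + deg (P :\: X) y.
  rewrite /deg -(cardsID X [set x in P | I x y]); congr (_ + _); apply: eq_card => x; rewrite !inE.
    case xX: (x \in X); rewrite ?andbF // andbT /=.
    by rewrite (subsetP sXP).
  by rewrite andbA.
set d := deg X y; set e := deg _ y; move=> ed d1.
have: q <= e by lia.
by move=> qe; apply: leq_mul => //; lia.
Qed.

(** Since [#|L| * q.+1 = #|P| * r], this says that the densities of [X] and [Y] sum to less than 1.
    Equality is possible when [X] is [set0] or [P]. *)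
Lemma design_ineq_strict : 1 < q -> 2 * q.+1 <= r * q.-1 -> X != set0 -> X != P ->
  #|X| * r + #|Y| * q.+1 < #|P| * r.
Proof.
move=> q1 rq X0 XP; case/set0Pn: (X0) => x xX; have xP := subsetP sXP _ xX.
have a0 : 0 < #|X| by rewrite card_gt0.
have cP := design_card_points xP.
have cE : #|P| = #|X| + #|P :\: X| by rewrite -(cardsID X P) (setIidPr sXP).
have e0 : 0 < #|P :\: X|.
  by rewrite card_gt0 setD_eq0; apply: contra XP => PX; rewrite eqEsubset sXP.
have [aq|aq] := leqP (#|X| * q.+1) (2 * q * r).
  rewrite -design_card_lines -(cardsID Y L) (setIidPr sYL) mulnDl [ltnRHS]addnC ltn_add2r.
  have [p [pa pb E1 E2]] := matching_sums.
  exact: matching_arith pa E1 E2 (cauchy_schwarz_nat _ _).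
have := matching_lines_bound (ltnW q1); move: cE cP e0 aq.
move: #|P :\: X| #|P| #|X| #|Y| => e v a b -> {v}; case: e => // e /= cP _ aq bq.
rewrite mulnDl ltn_add2l.
case: (q) q1 rq cP aq bq => [|[|k]] //= _ rq cP aq bq.
(* One less than the number of points outside [X] is [e], so [a + e = q * r], and the lower bound on
   [a] bounds [e] from above. *)
have e1 : e * k.+3 < k.+2 * r * k.+1 by have := congr1 (muln^~ k.+3) cP; rewrite /=; lia.
have : (b * k.+3) * (k.+2 * k.+1) < (e.+1 * r) * (k.+2 * k.+1).
  have h1 : b * (k.+2 * k.+1) * k.+3 <= e.+1 * e * k.+3 by rewrite leq_mul2r bq orbT.
  have h2 : e.+1 * (e * k.+3) < e.+1 * (k.+2 * r * k.+1) by rewrite ltn_mul2l e1.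
  lia.
by rewrite ltn_mul2r => /andP[].
Qed.

Lemma design_ineq : 1 < q -> 2 * q.+1 <= r * q.-1 ->
  #|X| * r + #|Y| * q.+1 <= #|P| * r.
Proof.
move=> q1 rq; have [X0|X0] := eqVneq X set0.
  by rewrite X0 cards0 -design_card_lines leq_mul2r subset_leq_card.
have [XP|XP] := eqVneq X P; last exact/ltnW/design_ineq_strict.
(* With no point outside [X], the pair count forces [Y] to be empty. *)
have := matching_lines_bound (ltnW q1); rewrite XP setDv cards0 leqn0 !muln_eq0.
case/or3P=> [/eqP->|/eqP|/eqP]; first by rewrite addn0.
  by move=> q0; rewrite q0 in q1.
lia.
Qed.
End Design.

(** * The Fano plane *)

Section Fano.
Variables (T1 T2 : finType) (P : {set T1}) (L : {set T2}) (I : T1 -> T2 -> bool).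
Hypothesis D : design P L I 2 3.
Hypothesis P0 : P != set0.
Implicit Types (S X : {set T1}) (Y : {set T2}).
Local Notation deg := (deg I).

Lemma fano_card_points : #|P| = 7.
Proof. by case/set0Pn: P0 => x /(design_card_points D). Qed.

Lemma fano_card_lines : #|L| = 7.
Proof. by have := design_card_lines D; rewrite fano_card_points; lia. Qed.

Definition triangle S := [/\ S \subset P, #|S| = 3 &
  ~ exists2 y, y \in L & {in S, forall x, I x y}].

Lemma degE_full S y : (deg S y == #|S|) = [forall x in S, I x y].
Proof.
have sub : [set x in S | I x y] \subset S by apply/subsetP=> x /setIdP[].
rewrite /deg eqn_leq subset_leq_card //= -[_ <= _]andTb -sub -eqEcard.
apply/eqP/forall_inP => [E x|H]; first by rewrite -{1}E => /setIdP[].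
by apply/setP=> x; rewrite inE; case xS: (x \in S) => //=; apply: H.
Qed.

Lemma triangle_deg S y : triangle S -> y \in L -> deg S y <= 2.
Proof.
case=> _ c3 nc yL; have : deg S y <= #|S| by apply/subset_leq_card/subsetP=> x /setIdP[].
rewrite leq_eqVlt degE_full c3 => /orP[/forall_inP H|//].
by case: nc; exists y.
Qed.

(** The lines adjoined to a triangle [S] in the mixed configurations. *)
Definition sparse S := [set y in L | deg S y <= 1].

Lemma triangle_card_sparse S : triangle S -> #|sparse S| = 4.
Proof.
move=> tS; case: (tS) => sSP c3 _.
have S1 := sum_deg D sSP; have S2 := sum_deg_sq D sSP; rewrite c3 /= in S1 S2.
(* For [d] in 0, 1, 2 one has [d ^ 2 + 2 * (d <= 1) = d + 2]; with first moment 9 and second moment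
   15 this leaves 4 sparse lines. *)
have : \sum_(y in L) (deg S y ^ 2 + ((deg S y <= 1) + (deg S y <= 1))) = \sum_(y in L) (deg S y + 2).
  apply: eq_bigr => y /(triangle_deg tS); by case: (deg S y) => [|[|[|]]].
rewrite !big_split /= S1 S2 sum_nat_const fano_card_lines.
have -> : \sum_(y in L) (deg S y <= 1) = #|sparse S|.
  rewrite -sum1_card.
  rewrite big_mkcond [RHS]big_mkcond /=; apply: eq_bigr => y _.
  by rewrite inE; case: (y \in L) => //=; case: (_ <= 1).
lia.
Qed.

(** The three lines through [x] have degree 1 or 2 and total degree 5, so exactly one has degree
    1. *)
Lemma triangle_sparse_at S x : triangle S -> x \in S -> #|[set y in sparse S | I x y]| <= 1.
Proof.
move=> tS xS; case: (tS) => sSP c3 _.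
have := sum_deg_at D sSP xS; rewrite c3.
pose Lx := [set y in L | I x y].
have cLx : #|Lx| = 3 by apply: (design_rep D); apply: (subsetP sSP).
have : \sum_(y in Lx) (deg S y + (deg S y <= 1)) = \sum_(y in Lx) 2.
  apply: eq_bigr => y /setIdP[yL xy]; have := triangle_deg tS yL.
  have : 0 < deg S y by apply/card_gt0P; exists x; rewrite inE xS.
  by case: (deg S y) => [|[|[|]]].
rewrite big_split /= sum_nat_const cLx => E Ed; rewrite Ed in E.
have: \sum_(y in Lx) (deg S y <= 1) = 1 by move: E; lia.
rewrite [LHS](bigID (mem (sparse S))) /= => E1; rewrite -sum1_card -E1.
apply: leq_trans (leq_addr _ _); rewrite leq_eqVlt; apply/orP; left; apply/eqP.
apply: eq_big => [y|y]; rewrite !inE; first by case: (y \in L); case: (I x y); case: (_ <= 1).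
by case/andP=> /andP[_ ->].
Qed.

(** Two points, and a third off their line, which has only 3 of the 7 points. *)
Lemma triangle_exists : exists S, triangle S.
Proof.
have /card_gt1P[x [y [xP yP xy]]] : 1 < #|P| by rewrite fano_card_points.
have /cards1P/= [l El] : #|[set l in L | I x l && I y l]| == 1 by rewrite (design_join D).
have /and3P[lL xl yl] : [&& l \in L, I x l & I y l].
  by have := set11 l; rewrite -El inE.
have /subsetPn[z zP zl] : ~~ (P \subset [set z in P | I z l]).
  apply/negP=> /subset_leq_card; rewrite fano_card_points.
  by have := design_line D lL; rewrite /deg => ->.
exists [set x; y; z]; split.
- by apply/subsetP=> w; rewrite !inE => /orP[/orP[]|] /eqP->.
- rewrite setUC cardsU1 cards2 xy !inE negb_or.
  have -> : z != x by apply: contraNneq zl => ->; rewrite inE xP xl.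
  by have -> : z != y by apply: contraNneq zl => ->; rewrite inE yP yl.
case=> m mL Hm.
have /eqP ml : m == l.
  by rewrite -in_set1 -El inE mL !Hm // !inE eqxx ?orbT.
by case/negP: zl; rewrite inE zP -ml Hm // !inE eqxx orbT.
Qed.

(** The hypotheses give [c <= a] and [c <= 7 - a], which leaves a finite check; only [a = c = p = 3]
    survives. *)
Lemma fano_arith a b p c s1 s2 : a <= b -> 0 < a -> 7 <= a + b -> b + c = 7 -> p <= a ->
  s1 + p = a * 3 -> s2 + p = a * (a.-1 + 3) -> s1 ^ 2 <= c * s2 ->
  [/\ a = 3, c = 3, s1 = 6 & s2 = 12].
Proof.
move=> ab a0 s7 bc pa E1 E2 CS.
have {}E1 : s1 = a * 3 - p by lia.
have {}E2 : s2 = a * (a.-1 + 3) - p by lia.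
rewrite E1 E2 in CS *.
have a7 : a <= 7 by lia.
have c3 : c <= a by lia.
have : c <= 7 - a by lia.
move: CS; clear - a0 pa a7 c3.
case: a a0 a7 pa c3 => [|[|[|[|[|[|[|[|]]]]]]]] // _ _.
all: case: p => [|[|[|[|[|[|[|[|]]]]]]]] // _.
all: by case: c => [|[|[|[|[|[|[|[|]]]]]]]] //.
Qed.

(** The case of more chosen points than lines is recovered later from the dual plane. *)
Lemma fano_matching X Y : X \subset P -> Y \subset L ->
  {in Y, forall y, deg X y <= 1} -> {in X, forall x, #|[set y in Y | I x y]| <= 1} ->
  #|X| <= #|Y| -> 7 <= #|X| + #|Y| ->
  X = set0 /\ Y = L \/ triangle X /\ Y = sparse X.
Proof.
move=> sXP sYL dX dY XY s7; have [X0|X0] := eqVneq X set0.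
  left; split=> //; apply/eqP; rewrite eqEcard sYL fano_card_lines.
  by move: s7; rewrite X0 cards0.
right; have [p [pa pb E1 E2]] := matching_sums D sXP sYL dX dY.
have cC : #|Y| + #|L :\: Y| = 7 by rewrite -fano_card_lines -(cardsID Y L) (setIidPr sYL).
have [] := fano_arith XY _ s7 cC pa E1 E2 (cauchy_schwarz_nat _ _); first by rewrite card_gt0.
move=> aX cX {}E1 {}E2.
have d2 : {in L :\: Y, forall y, deg X y = 2}.
  (* Equality in Cauchy-Schwarz: the sum of [(deg X y - 2) ^ 2] vanishes. *)
  have : \sum_(y in L :\: Y) (4 * deg X y) = \sum_(y in L :\: Y) (deg X y ^ 2 + 4).
    by rewrite -big_distrr big_split sum_nat_const /= E1 E2 cX.
  move=> Es y yC; move: Es; rewrite (bigD1 y) // [RHS](bigD1 y) //= => Es.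
  have : \sum_(i in L :\: Y | i != y) 4 * deg X i <= \sum_(i in L :\: Y | i != y) (deg X i ^ 2 + 4).
    by apply: leq_sum => i _; have [] := nat_Cauchy (deg X i) 2; lia.
  by have [] := nat_Cauchy (deg X y) 2; move: Es; nia.
split.
  split=> // -[y yL Hy].
  have dy3 : deg X y = 3 by apply/eqP; rewrite -aX degE_full; apply/forall_inP.
  have [yY|yY] := boolP (y \in Y); first by have := dX _ yY; rewrite dy3.
  by have := d2 y; rewrite inE yY yL dy3 => /(_ isT).
apply/setP=> y; rewrite inE; apply/idP/andP=> [yY|[yL dy]]; first by rewrite (subsetP sYL) ?dX.
by apply/negPn/negP=> yY; move: dy; rewrite d2 // inE yY yL.
Qed.
End Fano.

(** * The odd case *)

Section Local.
Variables (F : finFieldType) (n : nat).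
Local Notation q := #|F|.
Local Notation L := (subspaces F n).
Local Notation wv_free := (@wv_free poset_display L).
Local Notation level := (level F n).
Local Notation le := (fun U W : L => (U <= W)%VS).
Implicit Types (B U V W Z : L) (A X Y : {set L}).

Lemma qnat2 : qnat q 2 = q.+1.
Proof. by rewrite qnatSl /qnat big_ord1 muln1. Qed.

Lemma dim_cap_lt U W : ~~ (U <= W)%VS -> \dim (U :&: W)%VS < \dim U.
Proof.
move=> UW; rewrite ltn_neqAle dimvS ?capvSl // andbT; apply: contra UW => /eqP dC.
have /eqP <- : ((U :&: W)%VS == U) by rewrite eqEdim capvSl dC /=.
exact: capvSr.
Qed.

Lemma dim_join_adjacent k B U W : \dim B = k -> (B <= U)%VS -> (B <= W)%VS ->
  \dim U = k.+1 -> \dim W = k.+1 -> U != W -> \dim (U + W)%VS = k.+2.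
Proof.
move=> dB BU BW dU dW UW; have := dimv_sum_cap U W; rewrite dU dW.
have : k <= \dim (U :&: W)%VS by rewrite -dB dimvS // subv_cap BU.
have : \dim (U :&: W)%VS < k.+1.
  rewrite -dU dim_cap_lt //; apply: contra UW => le_UW.
  by apply/eqP/(@level_antichain F n k.+1); rewrite ?mem_level ?dU ?dW.
lia.
Qed.

(** These are the points and lines of the projective space of the quotient by [B], kept as subspaces
    over [B]; the line joining [U] and [U'] is [U + U']. *)
Lemma interval_design k B : \dim B = k ->
  design [set U in level k.+1 | (B <= U)%VS] [set W in level k.+2 | (B <= W)%VS] le
    q (qnat q (n - k.+1)).
Proof.
move=> dB; split.
- move=> U /setIdP[Uk BU]; move: Uk; rewrite mem_level => /eqP dU.
  rewrite -(card_level_above dU); apply: eq_card => W; rewrite !inE -andbA; congr (_ && _).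
  by apply/andP/idP=> [[]//|UW]; rewrite UW (subv_trans BU).
- move=> W /setIdP[Wk BW]; move: Wk; rewrite mem_level => /eqP dW.
  have := card_above BW; rewrite dW dB subSn ?leqnSn // subSnn qnat2 => <-.
  by apply: eq_card => U; rewrite !inE dB -andbA andbC -andbA.
move=> U U' /setIdP[Uk BU] /setIdP[Uk' BU'] UU'; move: Uk Uk'; rewrite !mem_level => /eqP dU /eqP dU'.
have dUU := dim_join_adjacent dB BU BU' dU dU' UU'.
apply: etrans (cards1 ((U + U')%VS : L)); apply: eq_card => W; rewrite !inE.
apply/idP/idP=> [/andP[/andP[/eqP dW BW] /andP[UW UW']]|/eqP->].
  by rewrite eq_sym eqEdim subv_add UW UW' dUU dW leqnn.
by rewrite dUU eqxx addvSl addvSr (subv_trans BU) // addvSl.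
Qed.

(** Counts the chains [B <= U <= W] by [B] and by [U]; each [B] leaves [[2] = q.+1] choices of
    [U]. *)
Lemma card_codim2 k W : \dim W = k.+2 ->
  #|[set B in level k | (B <= W)%VS]| * q.+1 = qnat q k.+2 * qnat q k.+1.
Proof.
move=> dW; rewrite -(card_level_below dW) -qnat2 -!sum_nat_const.
transitivity (\sum_(B in [set B in level k | (B <= W)%VS])
    #|[set U in [set U in level k.+1 | (U <= W)%VS] | (B <= U)%VS]|).
  apply: eq_bigr => B /setIdP[Bk BW]; move: Bk; rewrite mem_level => /eqP dB.
  have -> : 2 = \dim W - \dim B by rewrite dW dB; lia.
  rewrite -card_above //; apply: eq_card => U; rewrite !inE dB.
  by rewrite andbC; congr (_ && _); rewrite andbC.
rewrite double_count; apply: eq_bigr => U /setIdP[Uk UW]; move: Uk; rewrite mem_level => /eqP dU.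
rewrite -(card_level_below dU); apply: eq_card => B; rewrite !inE -andbA; congr (_ && _).
by apply/andP/idP=> [[]//|BU]; rewrite BU (subv_trans BU).
Qed.

(* For [U] in [X] and [W] outside [X] with the largest [\dim (U :&: W)], take a
   hyperplane [B] of [W] over [U :&: W] and [e] in [U] but not in [W]: whether or
   not [B + <[e]>] belongs to [X] is contradictory. *)
Lemma level_connected k X : X \subset level k.+1 -> X != set0 ->
  {in level k, forall B, [set U in X | (B <= U)%VS] = set0 \/
     [set U in X | (B <= U)%VS] = [set U in level k.+1 | (B <= U)%VS]} ->
  X = level k.+1.
Proof.
move=> sX /set0Pn[U UX] H; apply/eqP; rewrite eqEsubset sX /=; apply/negPn/negP.
move=> /subsetPn[W0 W0k W0X].
have [W /andP[Wk WX] maxW] : exists2 W, (W \in level k.+1) && (W \notin X) &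
    forall Z, (Z \in level k.+1) && (Z \notin X) -> \dim (U :&: Z)%VS <= \dim (U :&: W)%VS.
  exists [arg max_(W > W0 | (W \in level k.+1) && (W \notin X)) \dim (U :&: W)%VS].
    by case: arg_maxnP; rewrite ?W0k.
  by case: arg_maxnP; rewrite ?W0k.
have /eqP dU : \dim U == k.+1 by rewrite -mem_level (subsetP sX).
have /eqP dW : \dim W == k.+1 by rewrite -mem_level.
have UW : ~~ (U <= W)%VS.
  apply/negP=> UW; case/negP: WX; suff <- : U = W by [].
  by apply/eqP; rewrite eqEdim UW dU dW /=.
have /subvPn[e eU eW] := UW.
have dC : \dim (U :&: W)%VS < k.+1 by rewrite -dU dim_cap_lt.
have /card_gt0P[B] : 0 < #|below (U :&: W)%VS W|.
  by rewrite card_below ?capvSr // dW subSn // qnat_gt0.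
rewrite inE dW eqSS => /and3P[CB BW /eqP dB].
pose Z : L := (B + <[e]>)%VS.
have eB : e \notin B by apply: contra eW; apply: subvP.
have dZ : \dim Z = k.+1 by rewrite dim_add_vector // dB.
have Zk : Z \in level k.+1 by rewrite mem_level dZ.
have [ZX|ZX] := boolP (Z \in X).
  have Bk : B \in level k by rewrite mem_level dB.
  have : Z \in [set U in X | (B <= U)%VS] by rewrite inE ZX addvSl.
  case: (H B Bk) => ->; first by rewrite inE.
  move=> _; have := H B Bk; case=> E; first by move: (in_set0 Z); rewrite -E inE ZX addvSl.
  case/negP: WX; have : W \in [set U in level k.+1 | (B <= U)%VS] by rewrite inE Wk.
  by rewrite -E => /setIdP[].
(* The space [U :&: Z] contains [U :&: W] and also [e], against the choice of [W]. *)
have := maxW Z; rewrite Zk ZX => /(_ isT); apply/negP; rewrite -ltnNge.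
rewrite -(dim_add_vector (_ : e \notin (U :&: W)%VS)); last first.
  by rewrite memv_cap negb_and eW orbT.
apply: dimvS; rewrite subv_add !subv_cap capvSl -!memvE eU (subv_trans CB) ?addvSl //=.
by rewrite memvE addvSr.
Qed.

(** * Averaging the local inequality in odd dimension *)

Section Odd.
Variables (k : nat) (A : {set L}).
Hypotheses (nk : n = (2 * k.+1).+1) (maxA : maximum A).
Let X := A :&: level k.+1.
Let Y := A :&: level k.+2.

Lemma maximum_odd_split : A = X :|: Y.
Proof.
apply/setP=> U; rewrite !inE -andb_orr; case UA: (U \in A) => //=.
have n2 : 2 <= n by lia.
have := maximum_dim_le n2 maxA UA; have := maximum_dim_ge n2 maxA UA; lia.
Qed.

Lemma level_disjoint i j : i != j -> level i :&: level j = set0.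
Proof.
by move=> ij; apply/setP=> U; rewrite !inE; apply/negP=> /andP[/eqP-> /eqP E]; rewrite E eqxx in ij.
Qed.

Lemma maximum_odd_card : #|A| = #|X| + #|Y|.
Proof.
rewrite {1}maximum_odd_split cardsU /X /Y setIACA level_disjoint ?setI0 ?cards0 ?subn0 //.
by rewrite neq_ltn ltnSn.
Qed.

Local Notation r := (qnat q k.+2).
Local Notation over S B := [set U in S | (B <= U)%VS].

Lemma over_sub (S S' : {set L}) B : S \subset S' -> over S B \subset over S' B.
Proof. by move=> /subsetP sS; apply/subsetP=> U /setIdP[US BU]; rewrite inE sS. Qed.

Lemma maximum_odd_deg B : {in over Y B, forall W, deg le (over X B) W <= 1}.
Proof.
move=> W /setIdP[/setIP[WA]]; rewrite mem_level => /eqP dW _.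
apply: (@wv_free_card_le1 poset_display L A _ W) => //; first by case: maxA.
  by apply/subsetP=> U /setIdP[/setIdP[/setIP[]]].
move=> U /setIdP[/setIdP[/setIP[_]]]; rewrite mem_level => /eqP dU _ UW; split.
  by apply: contra_eq_neq dU => ->; rewrite dW neq_ltn ltnSn orbT.
by rewrite /Order.comparable; apply/orP; right.
Qed.

Lemma maximum_odd_codeg B :
  {in over X B, forall U, #|[set W in over Y B | (U <= W)%VS]| <= 1}.
Proof.
move=> U /setIdP[/setIP[UA]]; rewrite mem_level => /eqP dU _.
apply: (@wv_free_card_le1 poset_display L A _ U) => //; first by case: maxA.
  by apply/subsetP=> W /setIdP[/setIdP[/setIP[]]].
move=> W /setIdP[/setIdP[/setIP[_]]]; rewrite mem_level => /eqP dW _ UW; split.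
  by apply: contra_eq_neq dW => ->; rewrite dU neq_ltn ltnSn.
by rewrite /Order.comparable; apply/orP; left.
Qed.

Lemma codim_odd : n - k.+1 = k.+2.
Proof. by rewrite nk; lia. Qed.

Lemma sum_over (S : {set L}) i j g : S \subset level i ->
  {in level i, forall U, #|[set B in level j | (B <= U)%VS]| = g} ->
  \sum_(B in level j) #|over S B| = #|S| * g.
Proof.
move=> /subsetP sS H; rewrite double_count -sum_nat_const; apply: eq_bigr => U US.
exact/H/sS.
Qed.

(** The weights [r] and [q.+1] make every member of [A], of either dimension, contribute the same
    total, by [card_level_below] and [card_codim2]. *)
Lemma sum_over_line : \sum_(B in level k) (#|over X B| * r + #|over Y B| * q.+1) =
  #|A| * (qnat q k.+1 * r).
Proof.
have dX U : U \in level k.+1 -> #|[set B in level k | (B <= U)%VS]| = qnat q k.+1.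
  by rewrite mem_level => /eqP; apply: card_level_below.
rewrite big_split -!big_distrl /= (sum_over (subsetIr _ _) dX) maximum_odd_card.
rewrite mulnDl mulnA; congr (_ + _).
rewrite double_count -sum_nat_const big_distrl /=.
apply: eq_bigr => W /setIP[_]; rewrite mem_level => /eqP dW.
by rewrite card_codim2 // mulnC.
Qed.

Lemma sum_over_level : \sum_(B in level k) #|over (level k.+1) B| * r =
  #|level k.+1| * (qnat q k.+1 * r).
Proof.
rewrite -big_distrl /= (@sum_over _ k.+1 k (qnat q k.+1)) ?mulnA // => U.
by rewrite mem_level => /eqP; apply: card_level_below.
Qed.

(* Fails only for [k = 0] and [q = 2], the Fano plane. *)
Hypothesis gap : 2 * q.+1 <= r * q.-1.

Lemma local_ineq B : B \in level k ->
  #|over X B| * r + #|over Y B| * q.+1 <= #|over (level k.+1) B| * r.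
Proof.
rewrite mem_level => /eqP dB; have D := interval_design dB; rewrite codim_odd in D.
apply: (design_ineq D) gap; rewrite ?over_sub ?subsetIr ?card_field_gt1 //.
  exact: maximum_odd_deg.
exact: maximum_odd_codeg.
Qed.

Lemma local_ineq_strict B : B \in level k -> over X B != set0 ->
  over X B != over (level k.+1) B ->
  #|over X B| * r + #|over Y B| * q.+1 < #|over (level k.+1) B| * r.
Proof.
rewrite mem_level => /eqP dB; have D := interval_design dB; rewrite codim_odd in D.
apply: (design_ineq_strict D) gap; rewrite ?over_sub ?subsetIr ?card_field_gt1 //.
  exact: maximum_odd_deg.
exact: maximum_odd_codeg.
Qed.

(** Maximality turns the summed local inequality into an equality, so it is strict for no [B]: over
    each [B], [X] is empty or full, and [level_connected] applies once [X] is nonempty. *)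
Lemma maximum_odd : A = level k.+1 \/ A = level k.+2.
Proof.
have K0 : 0 < qnat q k.+1 * r by rewrite muln_gt0 !qnat_gt0.
have leA : #|A| <= #|level k.+1|.
  rewrite -(leq_pmul2r K0) -sum_over_line -sum_over_level; apply: leq_sum => B.
  exact: local_ineq.
case: (maxA) => _ mA; have geA i := mA _ (@level_wv_free F n i).
have EA : #|A| = #|level k.+1| by apply/eqP; rewrite eqn_leq leA geA.
have [X0|X0] := eqVneq X set0.
  right; apply/eqP; rewrite eqEcard geA andbT maximum_odd_split X0 set0U.
  exact: subsetIr.
left; have EX : X = level k.+1.
  apply: level_connected X0 _; first exact: subsetIr.
  move=> B Bk; have [|BX0] := eqVneq (over X B) set0; first by left.
  have [|BX1] := eqVneq (over X B) (over (level k.+1) B); first by right.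
  have : #|A| * (qnat q k.+1 * r) < #|level k.+1| * (qnat q k.+1 * r).
    rewrite -sum_over_line -sum_over_level (bigD1 B) // [ltnRHS](bigD1 B) //= -addSn leq_add //.
      exact: local_ineq_strict.
    by apply: leq_sum => C /andP[Ck _]; apply: local_ineq.
  by rewrite EA ltnn.
by apply/eqP; rewrite eq_sym eqEcard -{1}EX subsetIl EA leqnn.
Qed.
End Odd.
End Local.

(** * Extremal families in dimension three *)

(** The products [q.-1 * [3] = q ^ 3 - 1] and [q.-1 * [2] = q ^ 2 - 1] reach [2 * q.+1] from [q = 2]
    and from [q = 3] on, respectively. *)
Lemma gap_ineq q k : 1 < q -> 0 < k \/ 2 < q -> 2 * q.+1 <= qnat q k.+2 * q.-1.
Proof.
move=> q1 [k0|q2].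
  apply: leq_trans (_ : qnat q 3 * q.-1 <= _); last by rewrite leq_mul2r leq_qnat ?orbT.
  rewrite [leqRHS]mulnC qnatE; case: q q1 => [|[|q]] // _.
  by rewrite !expnS expn0; nia.
apply: leq_trans (_ : qnat q 2 * q.-1 <= _); last by rewrite leq_mul2r leq_qnat ?orbT.
rewrite [leqRHS]mulnC qnatE; case: q q2 {q1} => [|[|[|q]]] // _.
by rewrite !expnS expn0; nia.
Qed.

Section TwoLevels.
Variables (F : finFieldType) (n : nat).
Local Notation L := (subspaces F n).
Implicit Types (U V W Z : L) (A X Y : {set L}).

(** A converse to the degree bounds, used to show that the mixed Fano configurations are free. *)
Lemma two_level_wv_free i X Y : X \subset level F n i -> Y \subset level F n i.+1 ->
  {in Y, forall W, #|[set U in X | (U <= W)%VS]| <= 1} ->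
  {in X, forall U, #|[set W in Y | (U <= W)%VS]| <= 1} ->
  @wv_free poset_display L (X :|: Y).
Proof.
move=> /subsetP sX /subsetP sY dX dY.
have dimX U : U \in X -> \dim U = i by move/sX; rewrite mem_level => /eqP.
have dimY U : U \in Y -> \dim U = i.+1 by move/sY; rewrite mem_level => /eqP.
have cX U V : U \in X -> V \in X :|: Y -> V != U -> (U >=< V)%O -> V \in [set W in Y | (U <= W)%VS].
  move=> UX VXY VU cUV; have UV : (U <= V)%VS.
    case/orP: cUV => // VU'; have := dimvS VU'; rewrite (dimX U UX).
    case/setUP: VXY => [/dimX|/dimY] dV; rewrite dV ?ltnn // => _.
    by case/eqP: VU; apply/eqP; rewrite eqEdim [(V <= U)%VS]VU' dV (dimX U UX) /=.
  rewrite inE UV andbT; case/setUP: VXY => // /dimX dV.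
  by case/eqP: VU; apply/esym/eqP; rewrite eqEdim UV dV (dimX U UX) /=.
have cY U V : U \in Y -> V \in X :|: Y -> V != U -> (U >=< V)%O -> V \in [set W in X | (W <= U)%VS].
  move=> UY VXY VU cUV; have UV : (V <= U)%VS.
    case/orP: cUV => // VU'; have := dimvS VU'; rewrite (dimY U UY).
    case/setUP: VXY => [/dimX|/dimY] dV; rewrite dV ?ltnn // => _.
    by case/eqP: VU; apply/esym/eqP; rewrite eqEdim [(U <= V)%VS]VU' dV (dimY U UY) /=.
  rewrite inE UV andbT; case/setUP: VXY => // /dimY dV.
  by case/eqP: VU; apply/eqP; rewrite eqEdim UV dV (dimY U UY) /=.
have le1 (S : {set L}) a b : #|S| <= 1 -> a \in S -> b \in S -> a = b.
  by move=> S1 aS bS; apply: contraTeq S1 => ab; rewrite -ltnNge; apply/card_gt1P; exists a, b.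
move=> x y z; case/setUP=> [xX|xY] yA zA yx zx cy cz.
  by apply: (le1 _ _ _ (dY x xX)); apply: cX.
by apply: (le1 _ _ _ (dX x xY)); apply: cY.
Qed.

End TwoLevels.

(** * The subspaces of a 3-space over two elements as a Fano plane *)

Section FanoPlane.
Variable F : finFieldType.
Hypothesis q2 : #|F| = 2.
Local Notation L := (subspaces F 3).
Local Notation points := (level F 3 1).
Local Notation lines := (level F 3 2).
Local Notation le := (fun U W : L => (U <= W)%VS).
Local Notation ge := (fun U W : L => (W <= U)%VS).
Implicit Types (A S : {set L}).

(** Specializes results over a subspace [B] to [B = 0], where the local design is the whole
    plane. *)
Lemma over0 S : [set U in S | ((0%VS : L) <= U)%VS] = S.
Proof. by apply/setP=> U; rewrite inE sub0v andbT. Qed.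

Lemma fano_design : design points lines le 2 3.
Proof.
have := interval_design (dimv0 _ : \dim (0%VS : L) = 0).
by rewrite !over0 q2 /qnat !big_ord_recl big_ord0.
Qed.

(** Two distinct 2-dimensional subspaces of a 3-space meet in dimension 1, which is the dual of
    joining two points. *)
Lemma fano_dual_design : design lines points ge 2 3.
Proof.
have q3 : qnat 2 2 = 3 by rewrite /qnat !big_ord_recl big_ord0.
split=> [W|U|W W'].
- by rewrite mem_level => /eqP /card_level_below; rewrite q2 q3.
- by rewrite mem_level => /eqP /card_level_above; rewrite q2 q3.
rewrite !mem_level => /eqP dW /eqP dW' WW'.
have d1 : \dim (W :&: W')%VS = 1.
  have := dimv_sum_cap W W'; have := dim_le (W + W' : L)%VS; rewrite dW dW'.
  have : \dim (W :&: W')%VS < 2.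
    apply: leq_trans (dim_cap_lt _) _; rewrite ?dW //; apply: contra WW' => le_WW'.
    by apply/eqP/(@level_antichain F 3 2); rewrite ?mem_level ?dW ?dW'.
  lia.
apply: etrans (cards1 ((W :&: W')%VS : L)); apply: eq_card => U; rewrite !inE.
apply/idP/idP=> [/and3P[/eqP dU UW UW']|/eqP->].
  by rewrite eqEdim subv_cap UW UW' dU d1 /=.
by rewrite d1 eqxx capvSl capvSr.
Qed.

Lemma points_neq0 : points != set0.
Proof. by rewrite -card_gt0 card_level1 q2 /qnat !big_ord_recl. Qed.

Lemma card_points : #|points| = 7.
Proof. exact: fano_card_points fano_design points_neq0. Qed.

Lemma card_lines : #|lines| = 7.
Proof. exact: fano_card_lines fano_design points_neq0. Qed.

Lemma lines_neq0 : lines != set0.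
Proof. by rewrite -card_gt0 card_lines. Qed.

Lemma points_and_linesP A : points_and_lines A <->
  exists2 S, triangle points lines le S & A = S :|: sparse lines le S.
Proof.
split=> [[S [sS cS nS ->]]|[S [sS cS nS] ->]]; exists S; split => //.
Qed.

Lemma lines_and_pointsP A : lines_and_points A <->
  exists2 S, triangle lines points ge S & A = S :|: sparse points ge S.
Proof.
split=> [[S [sS cS nS ->]]|[S [sS cS nS] ->]]; exists S; split => //.
Qed.

Lemma triangle_points S : triangle points lines le S ->
  let A := S :|: sparse lines le S in
  [/\ @wv_free poset_display L A, #|A| = 7 & A :&: points = S].
Proof.
move=> tS /=; have [sS cS _] := tS.
have sl : sparse lines le S \subset lines by apply/subsetP=> W /setIdP[].
have dis : sparse lines le S :&: points = set0.
  by apply/eqP; rewrite -subset0 -(@level_disjoint F 3 2 1) // setSI.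
split.
- apply: (two_level_wv_free sS sl) => [W /setIdP[]//|U US].
  exact: (triangle_sparse_at fano_design points_neq0 tS US).
- rewrite cardsU cS (triangle_card_sparse fano_design points_neq0) //.
  rewrite (_ : _ :&: _ = set0) ?cards0 //; apply/eqP; rewrite -subset0 -dis setIC.
  by rewrite setIS.
by rewrite setIUl dis setU0; apply/setIidPl.
Qed.

Lemma triangle_lines S : triangle lines points ge S ->
  let A := S :|: sparse points ge S in
  [/\ @wv_free poset_display L A, #|A| = 7 & A :&: points = sparse points ge S].
Proof.
move=> tS /=; have [sS cS _] := tS.
have sl : sparse points ge S \subset points by apply/subsetP=> W /setIdP[].
have dis : S :&: points = set0.
  by apply/eqP; rewrite -subset0 -(@level_disjoint F 3 2 1) // setSI.
split.
- rewrite setUC; apply: (two_level_wv_free sl sS) => [W WS|U /setIdP[]//].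
  exact: (triangle_sparse_at fano_dual_design lines_neq0 tS WS).
- rewrite cardsU cS (triangle_card_sparse fano_dual_design lines_neq0) //.
  rewrite (_ : _ :&: _ = set0) ?cards0 //; apply/eqP; rewrite -subset0 -dis.
  by rewrite setIS.
by rewrite setIUl dis set0U; apply/setIidPl.
Qed.

(** The number of 1-dimensional members tells the four configurations apart. *)
Lemma fano_config_card (i : 'I_4) A : fano_config i A ->
  [/\ @wv_free poset_display L A, #|A| = 7 & #|A :&: points| = nth 0 [:: 7; 0; 3; 4] i].
Proof.
case: i => [[|[|[|[|//]]]] Hi]; rewrite /fano_config /=.
- by move->; rewrite setIid card_points; split=> //; apply: level_wv_free.
- by move->; rewrite level_disjoint // cards0 card_lines; split=> //; apply: level_wv_free.
- case/points_and_linesP=> S tS ->; have [fA cA ->] := triangle_points tS.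
  by split=> //; case: tS.
case/lines_and_pointsP=> S tS ->; have [fA cA ->] := triangle_lines tS.
by split=> //; rewrite (triangle_card_sparse fano_dual_design lines_neq0).
Qed.

Lemma fano_config_inj (i j : 'I_4) A : fano_config i A -> fano_config j A -> i = j.
Proof.
case/fano_config_card=> _ _ Ei /fano_config_card[_ _]; rewrite Ei => /eqP.
by rewrite nth_uniq ?ltn_ord // => /eqP /val_inj.
Qed.

Lemma fano_config_exists (i : 'I_4) : exists A : {set L}, fano_config i A.
Proof.
case: i => [[|[|[|[|//]]]] Hi]; rewrite /fano_config /=.
- by exists points.
- by exists lines.
- have [S tS] := triangle_exists fano_design points_neq0.
  by exists (S :|: sparse lines le S); apply/points_and_linesP; exists S.
have [S tS] := triangle_exists fano_dual_design lines_neq0.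
by exists (S :|: sparse points ge S); apply/lines_and_pointsP; exists S.
Qed.

Lemma maximum_fano A : maximum A -> exists i : 'I_4, fano_config i A.
Proof.
move=> mA; have n3 : 3 = (2 * 1).+1 by [].
have sX := subsetIr A points; have sY := subsetIr A lines.
have EA := maximum_odd_split n3 mA; have cA := maximum_odd_card n3 mA.
have dX := maximum_odd_deg (k := 0) mA (B := 0%VS); rewrite !over0 in dX.
have dY := maximum_odd_codeg (k := 0) mA (B := 0%VS); rewrite !over0 in dY.
have c7 : 7 <= #|A :&: points| + #|A :&: lines|.
  by rewrite -cA -card_points; case: mA => _; apply; apply: level_wv_free.
have [XY|YX] := leqP #|A :&: points| #|A :&: lines|.
  case: (fano_matching fano_design points_neq0 sX sY dX dY XY c7) => [[X0 Y1]|[tX Y1]].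
    by exists (@Ordinal 4 1 isT); rewrite /fano_config /= EA X0 Y1 set0U.
  exists (@Ordinal 4 2 isT); rewrite /fano_config /=; apply/points_and_linesP.
  by exists (A :&: points); rewrite // -Y1.
rewrite addnC in c7.
case: (fano_matching fano_dual_design lines_neq0 sY sX dY dX (ltnW YX) c7) => [[X0 Y1]|[tX Y1]].
  by exists (@Ordinal 4 0 isT); rewrite /fano_config /= EA X0 Y1 setU0.
exists (@Ordinal 4 3 isT); rewrite /fano_config /=; apply/lines_and_pointsP.
by exists (A :&: lines); rewrite // -Y1 setUC.
Qed.

End FanoPlane.

(** * Size and uniqueness in all dimensions *)

Lemma maximum_odd_large (F : finFieldType) n (A : {set subspaces F n}) : 2 <= n -> odd n ->
  3 < n \/ 2 < #|F| -> maximum A -> A = level F n n./2 \/ A = level F n (uphalf n).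
Proof.
move=> n2 on big mA; have := odd_double_half n; rewrite on uphalf_half on.
case: (n./2) => [|k] nk; first by lia.
have nk' : n = (2 * k.+1).+1 by lia.
rewrite add1n; apply: (maximum_odd nk' mA); apply: gap_ineq; first exact: card_field_gt1.
by case: big => [n3|]; [left; lia | right].
Qed.

Lemma maximum_card (F : finFieldType) n (A : {set subspaces F n}) : 2 <= n ->
  maximum A -> #|A| = #|level F n n./2|.
Proof.
move=> n2 mA; have [on|en] := boolP (odd n); last first.
  congr #|pred_of_set _|; apply: maximum_even mA => //.
  by have := odd_double_half n; rewrite (negbTE en); lia.
have [n3|n3] := eqVneq n 3; last first.
  have n4 : 3 < n by move: n2 on n3; clear; case: n => [|[|[|[|]]]].
  have [->|->] // := maximum_odd_large n2 on (or_introl n4) mA.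
  have := odd_double_half n; rewrite uphalf_half on => nE.
  (* The two middle levels have the same size by duality. *)
  rewrite -[RHS]card_level_sym; last by lia.
  by congr #|pred_of_set (level F n _)|; lia.
subst n; have q1 := card_field_gt1 F; have [q2|q2] := eqVneq #|F| 2.
  by have [i /(fano_config_card q2)[_ -> _]] := maximum_fano q2 mA; rewrite (card_points q2).
have q3 : 2 < #|F| by rewrite ltn_neqAle eq_sym q2.
have [->|->] // := maximum_odd_large n2 on (or_intror q3) mA.
by rewrite -[RHS]card_level_sym.
Qed.

Local Open Scope ring_scope.

(** That there are exactly 4 configurations is expressed by each class being inhabited and no family
    lying in two classes. *)
Theorem theoremA (n q : nat) (F : finFieldType)
    (hn : (2 <= n)%N) (hq : #|F| = q) :
  let largest (A : {set subspaces F n}) :=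
    #|A|%:R = qbinom q n n./2 /\ contains_none [:: wedge; vee] A in
  [/\ (extremal (subspaces F n) [:: wedge; vee])%:R = qbinom q n n./2,
      ~~ odd n ->
        forall A, largest A -> A = level F n n./2,
      odd n -> (3 < n)%N \/ (2 < q)%N ->
        forall A, largest A -> A = level F n n./2 \/ A = level F n (uphalf n)
    & n = 3%N -> q = 2%N ->
        [/\ forall A, largest A <-> exists i : 'I_4, fano_config i A,
            forall i : 'I_4, exists A : {set subspaces F n}, fano_config i A
          & forall (i j : 'I_4) (A : {set subspaces F n}),
              fano_config i A -> fano_config j A -> i = j]].
Proof.
move=> largest; subst q.
have cM : (#|level F n n./2|)%:R = qbinom #|F| n n./2.
  by apply: card_level; have := odd_double_half n; lia.
have [M mM] := exists_maximum F n.
(* By [maximum_card] a maximum family has the size of the middle level, so free families of that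
   size are precisely the maximum ones. *)
have largestP A : largest A <-> maximum A.
  rewrite /largest -cM; split=> [[/eqP cA /freeP fA]|mA].
    split=> // B fB; move: cA; rewrite eqr_nat -(maximum_card hn mM) => /eqP ->.
    by case: mM => _; apply.
  by rewrite (maximum_card hn mA); split=> //; apply/freeP; case: mA.
split.
- by rewrite (extremal_maximum mM) (maximum_card hn mM).
- move=> en A /largestP; apply: maximum_even => //.
  by have := odd_double_half n; rewrite (negbTE en); lia.
- by move=> on big A /largestP; apply: maximum_odd_large.
move=> n3 q2; clear M mM; subst n; split=> [A||].
- split=> [/largestP|[i Hi]]; first exact: maximum_fano.
  have [fA cA _] := fano_config_card q2 Hi.
  by rewrite /largest -cM cA card_points //; split=> //; apply/freeP.
- exact: fano_config_exists.
- by move=> i j A; apply: fano_config_inj.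
Qed.
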